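(* Let $(\Omega,\mathcal F)$ be a measurable space with at least three pairwise disjoint non-null events and $\succeq$ a preference order on $\mathcal L^\infty(\Omega,\mathcal F)$ satisfying (SM), (PC), (ST). Let $(\mathbb u,\mathbb P)$ be a pair where $\mathbb P$ is a probability on $\mathcal F$ with $\mathcal N_\succeq=\{\mathbb P=0\}$, $\mathbb u$ is $\mathcal F$-regular with $\mathbb u(\cdot,x)\in\mathcal L^1(\Omega,\mathcal F,\mathbb P)$ for all $x$, and $f\succeq g\iff\int\mathbb u(\omega,f(\omega))d\mathbb P\ge\int\mathbb u(\omega,g(\omega))d\mathbb P$. Then for every sub-$\sigma$-algebra $\mathcal G\subseteq\mathcal F$ and every $f\in\mathcal L^\infty(\Omega,\mathcal F)$, $\mathfrak m(f\mid\mathcal G)\neq\varnothing$, and there exist: (1) a $\mathcal G$-regular function $\mathbb u_{\mathcal G}:\Omega\times\mathbb R\to\mathbb R$ such that for every $x\in\mathbb R$, $\mathbb u_{\mathcal G}(\cdot,x)\in\mathcal L^1(\Omega,\mathcal G,\mathbb P)$ and $\mathbb u_{\mathcal G}(\cdot,x)$ is a version of $\mathbb E_{\mathbb P}[\mathbb u(\cdot,x)\mid\mathcal G]$; (2) a version $g$ of $\mathbb E_{\mathbb P}[\mathbb u(\cdot,f(\cdot))\mid\mathcal G]$ such that $\omega\mapsto\Phi_{\mathcal G}(\omega,g(\omega))$ belongs to $\mathfrak m(f\mid\mathcal G)$, where $\Phi_{\mathcal G}:\Omega\times\mathbb R\to[-\infty,+\infty]$, $\Phi_{\mathcal G}(\omega,x):=\inf\{y\in\mathbb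 R:\mathbb u_{\mathcal G}(\omega,y)>x\}$, is $\mathcal G\otimes\mathcal B_{\mathbb R}$-measurable.
   Context: $\mathcal L^\infty(\Omega,\mathcal F)$: bounded $\mathcal F$-measurable real functions. Preference order: complete transitive relation; $\succ,\sim$ as usual. Null events $\mathcal N_\succeq=\{A\in\mathcal F: f1_A+g1_{A^c}\sim g\ \forall f,g\}$. (SM): for non-null $A$, every $f$ and constants $x>y$: $x1_A+f1_{A^c}\succ y1_A+f1_{A^c}$. (ST): if $f1_A+h1_{A^c}\succeq g1_A+h1_{A^c}$ then $f1_A+\tilde h1_{A^c}\succeq g1_A+\tilde h1_{A^c}$ for every $\tilde h$. (PC): for uniformly bounded $f_n\to f$ pointwise and $g\succ f$ (resp. $f\succ g$) there is $N$ with $g\succ f_n$ (resp. $f_n\succ g$) for $n>N$. Conditional Chisini mean: $\mathfrak m(f\mid\mathcal G)=\{g\in\mathcal L^\infty(\Omega,\mathcal G): f1_A\sim g1_A\ \forall A\in\mathcal G\}$. A function $\varphi$ is $\mathcal G$-regular if $\varphi(\omega,\cdot)$ is continuous and strictly increasing for every $\omega$, $\varphi(\omega,0)=0$ for all $\omega$, and $\varphi$ is $\mathcal G\otimes\mathcal B_{\mathbb R}$-measurable. *)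

(* Defs.v *)
From HB Require Import structures.
From mathcomp Require Import all_boot all_order all_algebra.
From mathcomp Require Import all_classical all_reals all_analysis measurable_realfun.
Set Implicit Arguments. Unset Strict Implicit. Unset Printing Implicit Defensive.
Import Order.TTheory GRing.Theory Num.Theory.
Import numFieldNormedType.Exports.
Local Open Scope classical_set_scope.
Local Open Scope ring_scope.

Section Defs.
Context {d : measure_display} {T : measurableType d} {R : realType}.

Definition splice (A : set T) (f g : T -> R) : T -> R :=
  fun w => f w * \1_A w + g w * \1_(~` A) w.

Definition bounded_fun (f : T -> R) : Prop := exists M : R, forall w, `|f w| <= M.

Definition Linf (f : T -> R) : Prop := measurable_fun setT f /\ bounded_fun f.

Definition sub_sigma (G : set (set T)) : Prop :=
  sigma_algebra setT G /\ G `<=` measurable.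

Definition Gmeasurable (G : set (set T)) (h : T -> R) : Prop :=
  forall B : set R, measurable B -> G (h @^-1` B).

Definition LinfG (G : set (set T)) (h : T -> R) : Prop :=
  Gmeasurable G h /\ bounded_fun h.

Definition prod_sigma (G : set (set T)) : set (set (T * R)) :=
  smallest (sigma_algebra setT)
    (fun S => exists A B, G A /\ measurable B /\ S = A `*` B).

Definition regular (G : set (set T)) (phi : T -> R -> R) : Prop :=
  [/\ forall w, continuous (phi w),
      forall w, {homo phi w : x y / x < y},
      forall w, phi w 0 = 0 &
      forall B : set R, measurable B ->
        prod_sigma G ((fun p : T * R => phi p.1 p.2) @^-1` B)].

Section Pref.
Variable pref : (T -> R) -> (T -> R) -> Prop.

Definition pstrict f g := pref f g /\ ~ pref g f.
Definition psim f g := pref f g /\ pref g f.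

Definition preference_order : Prop :=
  (forall f g, Linf f -> Linf g -> pref f g \/ pref g f) /\
  (forall f g h, Linf f -> Linf g -> Linf h -> pref f g -> pref g h -> pref f h).

Definition null_event (A : set T) : Prop :=
  measurable A /\ forall f g, Linf f -> Linf g -> psim (splice A f g) g.

Definition SM : Prop :=
  forall A, measurable A -> ~ null_event A -> forall f, Linf f ->
  forall x y : R, y < x -> pstrict (splice A (cst x) f) (splice A (cst y) f).

Definition ST : Prop :=
  forall A, measurable A -> forall f g h h', Linf f -> Linf g -> Linf h -> Linf h' ->
  pref (splice A f h) (splice A g h) -> pref (splice A f h') (splice A g h').

Definition PC : Prop :=
  forall (fn : nat -> T -> R) (f g : T -> R),
  (forall n, Linf (fn n)) -> (exists M : R, forall n w, `|fn n w| <= M) ->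
  Linf f -> (forall w, fn n w @[n --> \oo] --> f w) -> Linf g ->
  (pstrict g f -> \forall n \near \oo, pstrict g (fn n)) /\
  (pstrict f g -> \forall n \near \oo, pstrict (fn n) g).

Definition chisini (G : set (set T)) (f : T -> R) : set (T -> R) :=
  fun h => LinfG G h /\
    forall A, G A -> psim (splice A f (cst 0)) (splice A h (cst 0)).
End Pref.

Definition cond_exp_version (P : probability T R) (G : set (set T)) (k h : T -> R) : Prop :=
  [/\ Gmeasurable G h, P.-integrable setT (EFin \o h) &
      forall A, G A -> (\int[P]_(w in A) (h w)%:E = \int[P]_(w in A) (k w)%:E)%E].

Definition PhiG (uG : T -> R -> R) (w : T) (x : R) : \bar R :=
  ereal_inf [set y%:E | y in [set y : R | x < uG w y]].

End Defs.

(* Main.v *)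
(* The sigma-algebra [G] is seen as the one generated by the identity map from
   [T] to [T] equipped with [G], so that conditional expectations are
   Radon-Nikodym derivatives of image charges.

   A regular version of x |-> E[u(., x) | G] is built from versions v_q at
   rational q.  Almost surely q |-> v_q is strictly increasing and v_0 = 0.  It
   is almost surely locally uniformly continuous too: u(w, .) is uniformly
   continuous on [-N, N], so all increments u(w, q + 1/k) - u(w, q) are at most
   e outside an event shrinking to the empty set as k grows; they are thus
   dominated by one integrable function tending to e, and conditioning this
   bound yields a k that works simultaneously for all q.  Extending v by
   continuity to the reals gives u_G.

   Approximating a bounded G-measurable h by rational step functions,
   E[u(., h) | G] = u_G(., h).  When |f| <= M, a version g of E[u(., f) | G] can
   be clamped between u_G(., - M) and u_G(., M); then h := Phi_G(., g) solves
   u_G(., h) = g with |h| <= M, hence the integrals of u(., h) and u(., f)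
   agree on every event of G, and h is a conditional Chisini mean. *)
Require Import Defs.
From HB Require Import structures.
From mathcomp Require Import all_boot all_order all_algebra.
From mathcomp Require Import all_classical all_reals all_analysis measurable_realfun.
From mathcomp Require Import lra.
Set Implicit Arguments. Unset Strict Implicit. Unset Printing Implicit Defensive.
Import Order.TTheory GRing.Theory Num.Theory.
Import numFieldNormedType.Exports.
Local Open Scope classical_set_scope.
Local Open Scope ring_scope.

(** * Extension of increasing functions from the rationals to the reals *)

Section rational_extension.
Context {R : realType}.
Implicit Types v : rat -> R.

(** The inequality is strict so that superlevel sets of the extension are countable unions of
    conditions on single rationals. *)
Definition rat_ext v (x : R) : R := sup [set v q | q in [set q | ratr q < x]].

(** For increasing [v] this one-sided condition amounts to uniform continuity on bounded sets of
    rationals. Letting [e] run through a sequence tending to 0 turns it into countably many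
    conditions, each of which may fail on a null set. *)
Definition small_increments v := forall (N : nat) (e : R), 0 < e ->
  exists k : nat, forall q : rat, `|q| <= N%:R -> v (q + k.+1%:R^-1) - v q <= e.

Lemma exists_rat_between (x y : R) : x < y -> exists q : rat, x < ratr q < y.
Proof. by move=> /rat_in_itvoo[q]; rewrite in_itv/= => ?; exists q. Qed.

Variable v : rat -> R.
Hypothesis v_incr : {homo v : p q / p < q}.

Let v_ndecr : {homo v : p q / p <= q}. Proof. exact: ltW_homo. Qed.

Let has_sup_rat_ext (x : R) : has_sup [set v q | q in [set q | ratr q < x]].
Proof.
split.
- have [q /andP[_ qx]] := @exists_rat_between (x - 1) x ltac:(lra).
  by exists (v q); exists q.
- have [p /andP[xp _]] := @exists_rat_between x (x + 1) ltac:(lra).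
  exists (v p) => _ [q /= qx <-]; apply: v_ndecr.
  by rewrite -(ler_rat R) ltW// (lt_trans qx).
Qed.

Lemma rat_ext_ge q (x : R) : ratr q < x -> v q <= rat_ext v x.
Proof. by move=> qx; apply: sup_upper_bound => //; exists q. Qed.

Lemma rat_ext_le q (x : R) : x <= ratr q -> rat_ext v x <= v q.
Proof.
move=> xq; apply: ge_sup; first by have [] := has_sup_rat_ext x.
move=> _ [p /= px <-]; apply: v_ndecr.
by rewrite -(ler_rat R) ltW// (lt_le_trans px).
Qed.

Lemma rat_ext_gtP (x c : R) : reflect (exists2 q, ratr q < x & c < v q) (c < rat_ext v x).
Proof.
apply: (iffP idP) => [/(sup_gt (has_sup_rat_ext x).1)[_ [q qx <-] cq]|[q qx cq]].
  by exists q.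
by rewrite (lt_le_trans cq)// rat_ext_ge.
Qed.

Lemma rat_ext_incr : {homo rat_ext v : x y / x < y}.
Proof.
move=> x y xy.
have [p /andP[xp py]] := exists_rat_between xy.
have [q /andP[pq qy]] := exists_rat_between py.
apply: (le_lt_trans (rat_ext_le (ltW xp))).
apply: (lt_le_trans _ (rat_ext_ge qy)).
by apply: v_incr; rewrite -(ltr_rat R).
Qed.

Hypothesis v_small : small_increments v.

Lemma rat_ext_continuous : continuous (rat_ext v).
Proof.
move=> x; apply/cvgrPdist_le => /= e e0.
have [k vk] := v_small (Num.truncn (`|x| + 1)).+1 e0.
have [t tE] : exists t : R, t = k.+1%:R^-1 by eexists.
have t0 : 0 < t by rewrite tE invr_gt0.
have t1 : t <= 1 by rewrite tE invf_le1// ler1n.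
(* Both [x] and every nearby [y] fall between [q] and [q + t], so both values of the extension lie
   between [v q] and [v (q + k.+1%:R^-1)], at most [e] apart. *)
have /exists_rat_between[q /andP[xq qx]] : x - t < x by rewrite gtrBl.
have rk : ratr (q + k.+1%:R^-1) = ratr q + t :> R.
  by rewrite rmorphD /= fmorphV /= ratr_nat tE.
have qN : `|q| <= (Num.truncn (`|x| + 1)).+1%:R.
  rewrite -(ler_rat R) ratr_norm ratr_nat; apply/ltW.
  apply: (le_lt_trans _ (truncnS_gt _)).
  by rewrite ler_norml; have := ler_norm x; have := ler_norm (- x); rewrite normrN => ? ?; lra.
have {}vk := vk _ qN.
near=> y.
have qy : ratr q < y by near: y; exact: lt_nbhsr.
have yq : y < ratr q + t.
  by near: y; apply: lt_nbhsl; rewrite -ltrBlDr.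
have := rat_ext_ge qy; have := rat_ext_ge qx.
have := @rat_ext_le (q + k.+1%:R^-1) y; rewrite rk => /(_ (ltW yq)).
have := @rat_ext_le (q + k.+1%:R^-1) x; rewrite rk -lerBlDr => /(_ (ltW xq)) ? ? ? ?.
by rewrite ler_norml; lra.
Unshelve. all: by end_near. Qed.

Lemma rat_extE q : rat_ext v (ratr q) = v q.
Proof.
apply/eqP; rewrite eq_le rat_ext_le//=; apply/ler_addgt0Pr => e e0.
have [k vk] := v_small (Num.truncn (`|q| + 1)).+1 e0.
have k0 : 0 < k.+1%:R^-1 :> rat by rewrite invr_gt0.
have k1 : k.+1%:R^-1 <= 1 :> rat by rewrite invf_le1// ler1n.
(* The supremum ignores [q] itself, so [v q] is compared with the value at the rational
   [q - k.+1%:R^-1] strictly below it. *)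
have /vk : `|q - k.+1%:R^-1| <= (Num.truncn (`|q| + 1)).+1%:R.
  apply/ltW; apply: (le_lt_trans _ (truncnS_gt _)).
  by rewrite (le_trans (ler_normB _ _))// lerD2l ger0_norm// ltW.
rewrite subrK.
have := @rat_ext_ge (q - k.+1%:R^-1) (ratr q); rewrite ltr_rat gtrBl => /(_ k0) ? ?; lra.
Qed.

End rational_extension.

Lemma small_increments_ratr {R : realType} : small_increments (@ratr R).
Proof.
move=> N e e0; exists (Num.truncn e^-1) => q _.
rewrite rmorphD /= addrAC subrr add0r fmorphV /= ratr_nat.
by rewrite -[leRHS]invrK lef_pV2 ?posrE ?invr_gt0// ltW// truncnS_gt.
Qed.

(** Compactness of [-N, N] makes uniform an estimate that holds jointly near each point and for
    large [k]. *)
Lemma continuous_small_increments {R : realType} (phi : R -> R) (N e : R) :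
  continuous phi -> 0 < e ->
  \forall k \near \oo, forall x, `|x| <= N -> phi (x + k.+1%:R^-1) - phi x <= e.
Proof.
move=> cphi e0.
have /compact_near_coveringP/(_ _ \oo (fun k x => phi (x + k.+1%:R^-1) - phi x <= e) _) :=
  @segment_compact R (- N) N.
move=> h; have : \forall k \near \oo, `[- N, N] `<=`
    (fun x => phi (x + k.+1%:R^-1) - phi x <= e).
  apply: h => x _.
  have /cvgrPdist_le/(_ (e / 2) ltac:(lra)) := cphi x.
  move=> /nbhs_ballP[r /= r0 xr].
  have r2 : 0 < r / 2 by lra.
  (* Halving the radius keeps both [y] and [y + t] in the ball of radius [r], where [phi] is within
     [e / 2] of [phi x]. *)
  exists (ball x (r / 2), [set k | k.+1%:R^-1 < r / 2]); first split => /=.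
  - exact: nbhsx_ballx.
  - near=> k => /=; rewrite -[ltRHS]invrK ltf_pV2 ?posrE ?invr_gt0//.
    rewrite (lt_trans (truncnS_gt _))// ltr_nat ltnS.
    by near: k; exact: nbhs_infty_gt.
  - move=> [y k]/= [+ kr]; rewrite /ball/= => xy.
    have [t tE] : exists t : R, t = k.+1%:R^-1 by eexists.
    have t0 : 0 < t by rewrite tE invr_gt0.
    move: kr; rewrite -tE => kr.
    have /xr/= : ball x r y by rewrite /ball/=; lra.
    have /xr/= : ball x r (y + t).
      by move: xy; rewrite /ball/= !ltr_norml => ?; lra.
    by rewrite !ler_norml => ? ?; lra.
apply: filterS => k hk x; rewrite ler_norml => xN; apply: hk.
by rewrite /= in_itv.
Unshelve. all: by end_near. Qed.

Lemma prod_sigma_measurableE {d} {S : measurableType d} {R : realType} :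
  prod_sigma (@measurable _ S) = @measurable _ (S * R)%type.
Proof.
rewrite measurable_prod_measurableType; congr (<<s _ >>).
apply/seteqP; split => X.
- by move=> [A [B [mA [mB ->]]]]; exists A => //; exists B.
- by move=> [A mA [B mB <-]]; exists A, B.
Qed.

(** * Regular functions: measurability, domination, limits of integrals *)

Section regular_functions.
Context {d : measure_display} {S : measurableType d} {R : realType}.
Implicit Types (phi : S -> R -> R) (h : S -> R).

Lemma regular_measurable_fun phi : regular measurable phi ->
  measurable_fun setT (fun p : S * R => phi p.1 p.2).
Proof.
by move=> [_ _ _ mphi] _ B mB; rewrite setTI -prod_sigma_measurableE; exact: mphi.
Qed.

Lemma measurable_regular_comp phi h : regular measurable phi ->
  measurable_fun setT h -> measurable_fun setT (fun s => phi s (h s)).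
Proof.
move=> /regular_measurable_fun mphi mh.
exact: (measurableT_comp mphi (measurable_fun_pair _ mh)).
Qed.

Lemma regular_ndecr phi s : regular measurable phi -> {homo phi s : x y / x <= y}.
Proof. by move=> [_ phi_incr _ _]; exact: ltW_homo. Qed.

Lemma regular_lt phi s : regular measurable phi -> {mono phi s : x y / x < y}.
Proof. by move=> [_ phi_incr _ _]; exact/leW_mono/le_mono. Qed.

Lemma regular_norm_le phi s x M : regular measurable phi -> `|x| <= M ->
  `|phi s x| <= `|phi s M| + `|phi s (- M)|.
Proof.
move=> rphi; rewrite ler_norml => /andP[Mx xM].
have := regular_ndecr s rphi Mx; have := regular_ndecr s rphi xM.
have := ler_norm (phi s M); have := ler_norm (- phi s (- M)).
have := normr_ge0 (phi s M); have := normr_ge0 (phi s (- M)).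
by rewrite normrN ler_norml => ? ? ? ? ? ?; lra.
Qed.

Section integrals.
Variables (mu : {measure set S -> \bar R}) (phi : S -> R -> R).
Hypothesis rphi : regular measurable phi.
Hypothesis iphi : forall q : rat, mu.-integrable setT (fun s => (phi s (ratr q))%:E).

(** By monotonicity this dominates [phi s x] for |x| at most [n]. The endpoints are integers because
    integrability is assumed at rational arguments. *)
Let dom (n : nat) s := `|phi s n%:R| + `|phi s (- n%:R)|.

Let integrable_dom n : mu.-integrable setT (EFin \o dom n).
Proof.
have -> : EFin \o dom n = (fun s => `|(phi s (ratr n%:R))%:E| +
    `|(phi s (ratr (- n%:R)))%:E|)%E.
  by apply/funext => s; rewrite /= -EFinD rmorphN/= ratr_nat.
by apply: integrableD => //; exact: integrable_abse.
Qed.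

Lemma integrable_regular_comp h : measurable_fun setT h -> Defs.bounded_fun h ->
  mu.-integrable setT (fun s => (phi s (h s))%:E).
Proof.
move=> mh [M hM].
apply: (le_integrable _ _ _ (integrable_dom (Num.truncn M).+1)) => //.
- exact/measurable_EFinP/measurable_regular_comp.
- move=> s _ /=; rewrite lee_fin [leRHS]ger0_norm ?addr_ge0//.
  by apply: regular_norm_le => //; rewrite (le_trans (hM s))// ltW// truncnS_gt.
Qed.

Lemma cvg_integral_regular_comp (hn : nat -> S -> R) h M A : measurable A ->
  (forall n, measurable_fun setT (hn n)) -> (forall n s, `|hn n s| <= M) ->
  (forall s, hn n s @[n --> \oo] --> h s) ->
  (\int[mu]_(s in A) (phi s (hn n s))%:E @[n --> \oo] -->
   \int[mu]_(s in A) (phi s (h s))%:E)%E.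
Proof.
move=> mA mhn hnM hnh.
apply: (@dominated_cvg _ _ _ _ _ mA _ _ (EFin \o dom (Num.truncn M).+1)) => //.
- move=> n; apply: measurable_funTS.
  exact/measurable_EFinP/measurable_regular_comp.
- move=> s _; apply/fine_cvgP; split; first exact: nearW.
  have [cphi _ _ _] := rphi.
  exact: (cvg_comp _ _ (hnh s) (cphi s (h s))).
- exact: (integrableS measurableT).
- move=> n s _ /=; rewrite lee_fin.
  by apply: regular_norm_le => //; rewrite (le_trans (hnM n s))// ltW// truncnS_gt.
Qed.

End integrals.
End regular_functions.

Lemma measurable_fun_to_nat {d} {S : measurableType d} (K : S -> nat) :
  (forall m, measurable (K @^-1` [set m])) -> measurable_fun setT K.
Proof.
move=> mK _ B _; rewrite setTI.
have -> : K @^-1` B = \bigcup_(m in B) K @^-1` [set m].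
  apply/seteqP; split => [s Bs|s [m Bm /= Ksm]].
    by exists (K s).
  by rewrite /preimage/= Ksm.
exact: bigcup_measurable.
Qed.

(** The integral of |h| over [B] vanishes, so [h] is almost everywhere zero on [B], where it is also
    positive. *)
Lemma integral_le0_null {d} {S : measurableType d} {R : realType}
    (mu : {measure set S -> \bar R}) (B : set S) (h : S -> R) : measurable B ->
  mu.-integrable B (EFin \o h) -> (forall s, B s -> 0 < h s) ->
  (\int[mu]_(s in B) (h s)%:E <= 0)%E -> mu B = 0%E.
Proof.
move=> mB ih h0 ih0.
have /(ae_eq_integral_abs mu mB (measurable_int _ ih)) :
    (\int[mu]_(s in B) `|(EFin \o h) s|)%E = 0%E.
  apply/eqP; rewrite eq_le integral_ge0// andbT; apply: le_trans ih0.
  rewrite le_eqVlt; apply/orP; left; apply/eqP/eq_integral => s /[!inE] Bs /=.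
  by rewrite gtr0_norm// h0.
move=> [N [mN N0 BN]]; apply: (subset_measure0 mB mN _ N0) => s Bs.
by apply: BN => /(_ Bs) /= [hs0]; have := h0 _ Bs; rewrite hs0 ltxx.
Qed.

Lemma measurable_preimage_mfun {d d'} {T : measurableType d} {S : measurableType d'}
    (X : {mfun T >-> S}) (B : set S) : measurable B -> measurable (X @^-1` B).
Proof.
by move=> mB; rewrite -[Z in measurable Z]setTI; exact: measurable_funP.
Qed.

(** * Conditional expectation given a random element *)

Section conditioning.
Context {d d' : measure_display} {T : measurableType d} {S : measurableType d'}.
Context {R : realType} (P : probability T R) (X : {mfun T >-> S}).
Implicit Types (k : T -> R) (v : S -> R).

Local Notation Q := (distribution P X).

(* The conditional expectation given [X], as a function of the value of [X]. *)
Definition is_cond_exp k v :=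
  [/\ measurable_fun setT v, Q.-integrable setT (EFin \o v) &
      forall B, measurable B ->
        (\int[Q]_(s in B) (v s)%:E = \int[P]_(w in X @^-1` B) (k w)%:E)%E].

Lemma cond_exp_exists k : P.-integrable setT (EFin \o k) -> exists v, is_cond_exp k v.
Proof.
move=> ik.
have mX : measurable_fun setT X by exact: measurable_funP.
(* The charge structure on a pushforward takes the measurability proof as an
   extra argument, so [nu_of] is a function of it. *)
pose nu_of : {charge set S -> \bar R} := pushforward (induced_charge ik) X.
pose nu := nu_of mX.
(* A [Q]-null set has a [P]-null preimage, over which [k] integrates to zero. *)
have nuQ : nu `<< Q.
  apply/null_content_dominatesP => B mB QB0.
  rewrite /nu/= /pushforward /induced_charge.
  apply: null_set_integral => //; first exact: measurable_preimage_mfun.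
  by apply: measurable_funTS; exact: measurable_int ik.
pose v := fine \o Radon_Nikodym nu Q.
have vE : EFin \o v = Radon_Nikodym nu Q.
  by apply/funext => s /=; rewrite fineK// Radon_Nikodym_fin_num.
exists v; split.
- apply/measurable_EFinP; rewrite vE.
  exact: measurable_int (Radon_Nikodym_integrable nuQ).
- by rewrite vE; exact: Radon_Nikodym_integrable.
- move=> B mB; under eq_integral do rewrite -[(v _)%:E]/((EFin \o v) _) vE.
  by rewrite -Radon_Nikodym_integral.
Qed.

Lemma is_cond_exp_ae k v v' : is_cond_exp k v -> measurable_fun setT v' ->
  v' = v %[ae Q] -> is_cond_exp k v'.
Proof.
move=> [mv /integrableP[_ iv] vE] mv' v'v; split => //.
  apply/integrableP; split; first exact/measurable_EFinP.
  apply: le_lt_trans iv; rewrite le_eqVlt; apply/orP; left; apply/eqP.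
  apply: ae_eq_integral => //.
  - by apply/measurableT_comp => //; exact/measurable_EFinP.
  - by apply/measurableT_comp => //; exact/measurable_EFinP.
  - by apply: filterS v'v => s /[apply] /= ->.
move=> B mB; rewrite -vE//; apply: ae_eq_integral => //.
- by apply: measurable_funTS; exact/measurable_EFinP.
- by apply: measurable_funTS; exact/measurable_EFinP.
- by apply: filterS v'v => s /(_ Logic.I) ->.
Qed.

(** On the event [B] where the inequality fails, [v1 - v2] is positive, yet its integral is that of
    [k1 - k2] over the preimage, hence nonpositive. *)
Lemma cond_exp_le_ae k1 k2 v1 v2 :
  P.-integrable setT (EFin \o k1) -> P.-integrable setT (EFin \o k2) ->
  is_cond_exp k1 v1 -> is_cond_exp k2 v2 -> (forall w, k1 w <= k2 w) ->
  {ae Q, forall s, v1 s <= v2 s}.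
Proof.
move=> ik1 ik2 [mv1 iv1 v1E] [mv2 iv2 v2E] k12.
pose B := [set s | v2 s < v1 s].
have mB : measurable B.
  have := measurable_fun_ltr mv2 mv1 measurableT (Y := [set true]) Logic.I.
  by rewrite setTI.
have mpB := measurable_preimage_mfun X mB.
exists B; split => //; last by move=> s /= /negP; rewrite -ltNge.
apply: (@integral_le0_null _ _ _ _ _ (fun s => v1 s - v2 s)) => //.
- apply: (@eq_integrable _ _ _ _ _ mB ((EFin \o v1) \- (EFin \o v2))%E) => //.
  by apply: integrableB => //; exact: (integrableS measurableT).
- by move=> s; rewrite subr_gt0.
rewrite integralB_EFin//; [|exact: (integrableS measurableT)..].
rewrite v1E// v2E// leeBlDl ?adde0; last first.
  by apply: integrable_fin_num => //; exact: (integrableS measurableT).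
apply: le_integral => //; [exact: (integrableS measurableT)..|].
by move=> w _; rewrite lee_fin.
Qed.

(** Here the positive integrand is [k2 - k1], on the preimage of [B]: its integral is that of
    [v2 - v1] over [B], hence nonpositive, and the preimage is [P]-null. *)
Lemma cond_exp_lt_ae k1 k2 v1 v2 :
  P.-integrable setT (EFin \o k1) -> P.-integrable setT (EFin \o k2) ->
  is_cond_exp k1 v1 -> is_cond_exp k2 v2 -> (forall w, k1 w < k2 w) ->
  {ae Q, forall s, v1 s < v2 s}.
Proof.
move=> ik1 ik2 [mv1 iv1 v1E] [mv2 iv2 v2E] k12.
pose B := [set s | v2 s <= v1 s].
have mB : measurable B.
  have := measurable_fun_ler mv2 mv1 measurableT (Y := [set true]) Logic.I.
  by rewrite setTI.
have mpB := measurable_preimage_mfun X mB.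
exists B; split => //; last by move=> s /= /negP; rewrite -leNgt.
apply: (@integral_le0_null _ _ _ P (X @^-1` B) (fun w => k2 w - k1 w)) => //.
- apply: (@eq_integrable _ _ _ _ _ mpB ((EFin \o k2) \- (EFin \o k1))%E) => //.
  by apply: integrableB => //; exact: (integrableS measurableT).
- by move=> w _; rewrite subr_gt0.
rewrite integralB_EFin//; [|exact: (integrableS measurableT)..].
rewrite -v1E// -v2E// leeBlDl ?adde0; last first.
  by apply: integrable_fin_num => //; exact: (integrableS measurableT).
apply: le_integral => //; [exact: (integrableS measurableT)..|].
by move=> w /[!inE].
Qed.

(** * Substituting a bounded function of the conditioning variable *)

Section composition.
Variables (phi : S -> R -> R) (psi : T -> R -> R).
Hypotheses (rphi : regular measurable phi) (rpsi : regular measurable psi).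
Hypothesis ipsi : forall q : rat, P.-integrable setT (fun w => (psi w (ratr q))%:E).
Hypothesis phiE : forall q : rat, is_cond_exp (psi^~ (ratr q)) (phi^~ (ratr q)).

Let iphi q : Q.-integrable setT (fun s => (phi s (ratr q))%:E).
Proof. by have [] := phiE q. Qed.

Let measurable_nat_comp (c : nat -> R) (K : S -> nat) :
  measurable_fun setT K -> measurable_fun setT (c \o K).
Proof. by move=> mK; apply: measurableT_comp mK. Qed.

(** The case of finitely many rational values, by induction on [m]: the level set where [K] is [m]
    is split off, and on it the argument is the constant rational [c m]. *)
Let integral_regular_comp_nat (c : nat -> rat) (K : S -> nat) m B :
  measurable_fun setT K -> measurable B -> (forall s, B s -> (K s < m)%N) ->
  (\int[Q]_(s in B) (phi s (ratr (c (K s))))%:E =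
   \int[P]_(w in X @^-1` B) (psi w (ratr (c (K (X w)))))%:E)%E.
Proof.
move=> mK; elim: m B => [|m IHm] B mB BK.
  have -> : B = set0 by apply/seteqP; split => // s /BK.
  by rewrite preimage_set0 !integral_set0.
have mKm : measurable (K @^-1` [set m]) by rewrite -[Z in measurable Z]setTI; exact: mK.
have mB1 : measurable (B `&` K @^-1` [set m]) by exact: measurableI.
have mB2 : measurable (B `\` K @^-1` [set m]) by exact: measurableD.
have mcK : measurable_fun setT (fun s => ratr (c (K s)) : R).
  exact: (measurable_nat_comp (fun n => ratr (c n)) mK).
have disj : [disjoint B `&` K @^-1` [set m] & B `\` K @^-1` [set m]].
  by apply/disj_setPS => s [[_ Ks] [_ /(_ Ks)]].
rewrite -[in LHS](setUIDK B (K @^-1` [set m])) -[in RHS](setUIDK B (K @^-1` [set m])).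
rewrite preimage_setU [in LHS]integral_setU//; last first.
  by apply: measurable_funTS; apply/measurable_EFinP; exact: measurable_regular_comp.
rewrite [in RHS]integral_setU//; first last.
- apply/disj_setPS => w [ws1 ws2].
  by have [_ /(_ ws1.2)] := ws2.
- apply: measurable_funTS; apply/measurable_EFinP.
  apply: measurable_regular_comp => //.
  exact: (measurableT_comp mcK).
- exact: measurable_preimage_mfun.
- exact: measurable_preimage_mfun.
congr (_ + _)%E; last first.
  apply: IHm => // s [Bs /eqP Ksm].
  by have := BK _ Bs; rewrite ltnS leq_eqVlt (negbTE Ksm).
rewrite (eq_integral (fun s => (phi s (ratr (c m)))%:E)); last first.
  by move=> s; rewrite inE => -[_ /= ->].
have [_ _ ->//] := phiE (c m).
by apply: eq_integral => w; rewrite inE => -[_ /= ->].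
Qed.

Lemma integral_cond_exp_comp h B : measurable_fun setT h -> Defs.bounded_fun h ->
  measurable B -> (\int[Q]_(s in B) (phi s (h s))%:E =
    \int[P]_(w in X @^-1` B) (psi w (h (X w)))%:E)%E.
Proof.
move=> mh [M0 hM0] mB.
pose M := (Num.truncn M0).+1.
have hM s : `|h s| <= M%:R.
  by rewrite (le_trans (hM0 s))// ltW// truncnS_gt.
have hM_ge0 s : 0 <= h s + M%:R.
  by have := hM s; rewrite ler_norml => /andP[? _]; lra.
(* Adding [M] makes the argument nonnegative before taking integer parts; [hn n] is then [h] rounded
   down to a multiple of 1/(n+1). *)
pose K (n : nat) s := Num.truncn ((h s + M%:R) * n.+1%:R).
pose c (n : nat) (m : nat) : rat := m%:R / n.+1%:R - M%:R.
pose hn n s : R := ratr (c n (K n s)).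
have mK n : measurable_fun setT (K n).
  apply: measurable_fun_to_nat => m.
  have -> : K n @^-1` [set m] = (fun s => (h s + M%:R) * n.+1%:R) @^-1` `[m%:R, m.+1%:R[.
    apply/seteqP; split => s /=; rewrite in_itv/= /K.
      by move=> <-; rewrite truncn_itv// mulr_ge0.
    by move=> /truncn_def.
  rewrite -[Z in measurable Z]setTI.
  have -> : (fun s => (h s + M%:R) * n.+1%:R) = (h \+ cst M%:R) \* cst n.+1%:R by [].
  by apply: measurable_funM => //; exact: measurable_funD.
have mhn n : measurable_fun setT (hn n).
  exact: (measurable_nat_comp (fun m => ratr (c n m)) (mK n)).
have hnE n s : hn n s = (K n s)%:R / n.+1%:R - M%:R.
  by rewrite /hn /c rmorphB /= fmorph_div /= !ratr_nat.
have hn_bnd n s : h s - n.+1%:R^-1 <= hn n s <= h s.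
  have /andP[K1 K2] := truncn_itv (mulr_ge0 (hM_ge0 s) (ler0n R n.+1)).
  rewrite -/(K n s) in K1 K2; rewrite hnE.
  rewrite -ler_pdivrMr// in K1; rewrite -ltr_pdivlMr// -natr1 mulrDl div1r in K2.
  move: K1 K2; move: ((K n s)%:R / n.+1%:R : R) (n.+1%:R^-1 : R) => a t K1 K2; lra.
have hn_le n s : `|hn n s| <= M%:R + 1.
  have n1 : n.+1%:R^-1 <= 1 :> R by rewrite invf_le1// ler1n.
  have /andP[h1 h2] := hn_bnd n s.
  have := hM s; rewrite !ler_norml => /andP[h3 h4]; apply/andP; split.
    rewrite (le_trans _ h1)// opprD lerD// lerN2//.
  by rewrite (le_trans h2)// (le_trans h4)// lerDl.
have hnh s : hn n s @[n --> \oo] --> h s.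
  apply/cvgrPdist_le => /= e e0; near=> n.
  have /andP[h1 h2] := hn_bnd n s.
  rewrite ger0_norm ?subr_ge0// lerBlDr -lerBlDl (le_trans _ h1)// lerD2l lerN2.
  rewrite -[leRHS]invrK lef_pV2 ?posrE ?invr_gt0//.
  rewrite (le_trans (ltW (truncnS_gt _)))// ler_nat ltnS.
  by near: n; exact: nbhs_infty_ge.
have cvgS := cvg_integral_regular_comp rphi iphi mB mhn hn_le hnh.
have cvgT := cvg_integral_regular_comp rpsi ipsi (measurable_preimage_mfun X mB)
  (fun n => measurableT_comp (mhn n) (measurable_funP X))
  (fun n w => hn_le n (X w)) (fun w => hnh (X w)).
apply: (cvg_unique _ cvgS) => //.
suff <- : (fun n => \int[P]_(w in X @^-1` B) (psi w (hn n (X w)))%:E)%E =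
    (fun n => \int[Q]_(s in B) (phi s (hn n s))%:E)%E by [].
apply/funext => n; apply/esym.
(* Since [h + M] is at most [2 M], [K n] is at most [2 M (n+1)]; the successor makes the bound
   strict. *)
apply: (@integral_regular_comp_nat (c n) (K n) (2 * M * n.+1).+1) => // s _.
rewrite /K truncn_lt_nat ?mulr_ge0// -[ltRHS]natr1 ltr_pwDr// natrM ler_pM2r// mul2n -addnn.
by rewrite natrD lerD2r (le_trans (ler_norm _)).
Unshelve. all: by end_near. Qed.

End composition.
End conditioning.

(** * Gluing functions, and almost-everywhere and measurability tools *)

Section splice.
Context {d : measure_display} {T : measurableType d} {R : realType}.
Implicit Types (A : set T) (f g : T -> R).

Lemma splice_in A f g w : A w -> splice A f g w = f w.
Proof.
by move=> Aw; rewrite /splice !indicE mem_set// memNset ?mulr1 ?mulr0 ?addr0// => /(_ Aw).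
Qed.

Lemma splice_out A f g w : ~ A w -> splice A f g w = g w.
Proof.
by move=> Aw; rewrite /splice !indicE memNset// mem_set// mulr1 mulr0 add0r.
Qed.

Lemma measurable_splice A f g : measurable A -> measurable_fun setT f ->
  measurable_fun setT g -> measurable_fun setT (splice A f g).
Proof.
move=> mA mf mg; apply: measurable_funD; apply: measurable_funM => //.
by apply: measurable_indic; exact: measurableC.
Qed.

End splice.

Lemma ae_forall_countable {d} {S : measurableType d} {R : realType}
    (mu : {measure set S -> \bar R}) (I : countType) (F : I -> S -> Prop) :
  (forall i, {ae mu, forall s, F i s}) -> {ae mu, forall s, forall i, F i s}.
Proof.
move=> aeF.
have : {ae mu, forall s, forall n, if unpickle n is Some i then F i s else True}.
  by apply: ae_foralln => n; case: unpickle => [i|]; [exact: aeF|exact: aeW].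
by apply: filterS => s h i; have := h (pickle i); rewrite pickleK.
Qed.

Lemma measurable_rat_ext {d} {S : measurableType d} {R : realType}
    (v : rat -> S -> R) : (forall q, measurable_fun setT (v q)) ->
  (forall s, {homo v^~ s : p q / p < q}) ->
  measurable_fun setT (fun p : S * R => rat_ext (v^~ p.1) p.2).
Proof.
move=> mv v_incr; apply: (measurability _ (RGenOInfty.measurableE R)) => //.
move=> /= _ [_ [c ->] <-]; rewrite setTI preimage_itvoy.
(* A superlevel set of the extension, jointly in point and argument, is a countable union of
   measurable rectangles. *)
rewrite [Z in measurable Z](_ : _ = \bigcup_(q : rat)
    ([set s | c < v q s] `*` `]ratr q, +oo[%classic)).
  apply: bigcupT_measurable_rat => q; apply: measurableX => //.
  by rewrite -preimage_itvoy -[Z in measurable Z]setTI; exact: mv.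
apply/seteqP; split => [[s x] /= /(rat_ext_gtP (v_incr s))[q qx cq]|].
  by exists q => //; split => //=; rewrite in_itv/= qx.
move=> [s x] [q _ [/= cq]]; rewrite in_itv/= andbT => qx.
by apply/(rat_ext_gtP (v_incr s)); exists q.
Qed.

(** * A regular version of the conditional utility *)

Section conditional_utility.
Context {d d' : measure_display} {T : measurableType d} {S : measurableType d'}.
Context {R : realType} (P : probability T R) (X : {mfun T >-> S}).

Local Notation Q := (distribution P X).
Local Notation is_cond_exp := (is_cond_exp P X).

Lemma is_cond_expB (k1 k2 : T -> R) (v1 v2 : S -> R) :
  P.-integrable setT (EFin \o k1) -> P.-integrable setT (EFin \o k2) ->
  is_cond_exp k1 v1 -> is_cond_exp k2 v2 -> is_cond_exp (k1 \- k2) (v1 \- v2).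
Proof.
move=> ik1 ik2 [mv1 iv1 v1E] [mv2 iv2 v2E]; split.
- exact: measurable_funB.
- exact: (integrableB measurableT iv1 iv2).
- move=> B mB; have mXB := measurable_preimage_mfun X mB.
  rewrite !integralB_EFin//; [|exact: (integrableS measurableT)..].
  by rewrite v1E// v2E.
Qed.

Variables (u : T -> R -> R) (v : rat -> S -> R).
Hypothesis ru : regular measurable u.
Hypothesis iu : forall q : rat, P.-integrable setT (fun w => (u w (ratr q))%:E).
Hypothesis vE : forall q : rat, is_cond_exp (u^~ (ratr q)) (v q).

Let ae_incr : {ae Q, forall s, {homo v^~ s : p q / p < q}}.
Proof.
have : {ae Q, forall s, forall pq : rat * rat, pq.1 < pq.2 -> v pq.1 s < v pq.2 s}.
  apply: ae_forall_countable => -[p q] /=.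
  have [pq|pq] := ltP p q; last by apply: aeW => s.
  apply: filterS (cond_exp_lt_ae (iu p) (iu q) (vE p) (vE q) _) => //.
  by have [_ u_incr _ _] := ru => w; apply: u_incr; rewrite ltr_rat.
by apply: filterS => s h p q; exact: (h (p, q)).
Qed.

Let ae_0 : {ae Q, forall s, v 0 s = 0}.
Proof.
have u0 w : u w (ratr 0) = 0 by have [_ _ u0 _] := ru; rewrite rmorph0.
have [_ i0 v0E] := vE 0.
have : ae_eq Q setT (EFin \o v 0) (cst 0%E).
  apply: integral_ae_eq => //.
  move=> B _ mB; rewrite integral_cst// mul0e v0E// integral0_eq// => w _.
  by rewrite u0.
by apply: filterS => s /(_ Logic.I) /= [].
Qed.

Section modulus.
Variables (N : nat) (e : R).
Hypothesis e0 : 0 < e.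

(** The exceptional event where some rational increment is too large. Continuity of [u w] puts each
    [w] outside [C k] for all large [k]. *)
Let C k := \bigcup_(q : rat) [set w | `|q| <= N%:R /\
  e < u w (ratr (q + k.+1%:R^-1)) - u w (ratr q)].

Let measurable_C k : measurable (C k).
Proof.
apply: bigcupT_measurable_rat => q.
have [qN|qN] := boolP (`|q| <= N%:R); last first.
  by rewrite [Z in measurable Z](_ : _ = set0)//; apply/seteqP; split => // w [].
rewrite [Z in measurable Z](_ : _ = setT `&` [set w |
   e < (u^~ (ratr (q + k.+1%:R^-1)) \- u^~ (ratr q)) w]); last first.
  by apply/seteqP; split => // w [].
rewrite -preimage_itvoy.
by apply: measurable_funB => //; exact: measurable_regular_comp.
Qed.

(* Off [C k] the increments are at most [e]; on [C k] they are at most [range],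
   so [cap k] dominates them all at once, for every [q] in [-N, N]. *)
Let range w := u w (ratr N.+1%:R) - u w (ratr (- N%:R)).
Let cap k w := e + range w * \1_(C k) w.

Let range_ge0 w : 0 <= range w.
Proof.
rewrite subr_ge0; apply: regular_ndecr => //.
by rewrite ler_rat (@le_trans _ _ 0)// oppr_le0.
Qed.

Let integrable_range : P.-integrable setT (EFin \o range).
Proof. exact: (integrableB measurableT (iu _) (iu _)). Qed.

Let measurable_cap k : measurable_fun setT (cap k).
Proof.
apply: measurable_funD => //; apply: measurable_funM.
  by apply: measurable_funB; exact: measurable_regular_comp.
exact: measurable_indic.
Qed.

Let bound w := e + range w.

Let integrable_bound : P.-integrable setT (EFin \o bound).
Proof.
exact: (integrableD measurableT (finite_measure_integrable_cst P e measurableT) integrable_range).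
Qed.

Let cap_bound k w : `|cap k w| <= bound w.
Proof.
by rewrite ger0_norm ?addr_ge0 ?mulr_ge0// ?(ltW e0)// lerD2l ler_piMr.
Qed.

Let integrable_cap k : P.-integrable setT (EFin \o cap k).
Proof.
apply: le_integrable integrable_bound => //; first exact/measurable_EFinP.
by move=> w _ /=; rewrite lee_fin (le_trans (cap_bound k w))// ler_norm.
Qed.

Let increment_le_cap k q w : `|q| <= N%:R ->
  u w (ratr (q + k.+1%:R^-1)) - u w (ratr q) <= cap k w.
Proof.
move=> qN; rewrite /cap indicE; have [Cw|Cw] := boolP (w \in C k); last first.
  rewrite mulr0 addr0 leNgt; apply/negP => ltu.
  by move/negP: Cw; apply; rewrite inE; exists q.
(* A step of at most 1 keeps both points in [-N, N+1], the interval over which [range] is the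
   increment. *)
have k1 : k.+1%:R^-1 <= 1 :> rat by rewrite invf_le1// ler1n.
move: qN; rewrite ler_norml => /andP[Nq qN].
rewrite mulr1 -[leLHS]add0r lerD ?(ltW e0)// lerB//; apply: regular_ndecr => //.
  by rewrite ler_rat -[leRHS]natr1 lerD.
by rewrite ler_rat.
Qed.

Let cvg_cap w : cap k w @[k --> \oo] --> e.
Proof.
apply: cvg_near_cst.
have [cu _ _ _] := ru.
have := continuous_small_increments N%:R (cu w) e0.
apply: filterS => k hk; rewrite /cap indicE memNset ?mulr0 ?addr0// => -[q _ [qN]].
rewrite ltNge => /negP; apply.
rewrite rmorphD/= fmorphV/= ratr_nat; apply: hk.
by rewrite -ratr_norm -[N%:R](@ratr_nat R) ler_rat.
Qed.

Lemma ae_cond_exp_increment : {ae Q, forall s, exists k : nat, forall q : rat,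
  `|q| <= N%:R -> v (q + k.+1%:R^-1) s - v q s <= 2 * e}.
Proof.
have /choice[c cE] : forall k, exists ck, is_cond_exp (cap k) ck.
  by move=> k; exact: cond_exp_exists.
have le_c : {ae Q, forall s, forall kq : nat * rat, `|kq.2| <= N%:R ->
    v (kq.2 + kq.1.+1%:R^-1) s - v kq.2 s <= c kq.1 s}.
  apply: ae_forall_countable => -[k q] /=.
  have [qN|qN] := boolP (`|q| <= N%:R); last by apply: aeW => s.
  have vB := is_cond_expB (iu _) (iu _) (vE (q + k.+1%:R^-1)) (vE q).
  apply: filterS (cond_exp_le_ae _ _ vB (cE k) _) => //.
    exact: (integrableB measurableT (iu _) (iu _)).
  by move=> w; exact: increment_le_cap.
(* Outside [B] some [k] has [c k s] below [2 e] and serves every [q]. The factor 2 leaves a gap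
   above the limit [e] of [cap k], which forces [B] to be null. *)
pose B := \bigcap_k [set s | 2 * e <= c k s].
have mB : measurable B.
  apply: bigcapT_measurable => k; rewrite -preimage_itvcy -[Z in measurable Z]setTI.
  by have [mc _ _] := cE k; exact: mc.
have mXB := measurable_preimage_mfun X mB.
have QB0 : Q B = 0%E.
  have cvg_e : (\int[P]_(w in X @^-1` B) (cap k w)%:E @[k --> \oo] -->
      \int[P]_(w in X @^-1` B) e%:E)%E.
    apply: (@dominated_cvg _ _ _ _ _ mXB _ _ (EFin \o bound)) => //.
    - by move=> k; apply: measurable_funTS; exact/measurable_EFinP.
    - by move=> w _; apply/fine_cvgP; split; [exact: nearW|exact: cvg_cap].
    - exact: (integrableS measurableT).
    - by move=> k w _; rewrite lee_fin.
  (* [cap k] tends to [e] while its conditional expectation stays above [2 e]. *)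
  have : ((2 * e)%:E * Q B <= e%:E * Q B)%E.
    rewrite -[leRHS](integral_cst P mXB) -integral_cst//.
    apply: cvge_ge cvg_e; apply: nearW => k.
    have [_ ick <-//] := cE k.
    apply: le_integral => //.
    - exact: finite_measure_integrable_cst.
    - exact: (integrableS measurableT).
    - by move=> s /[!inE] /(_ k Logic.I); rewrite lee_fin.
  have QBfin : Q B \is a fin_num by exact: fin_num_measure.
  rewrite -(fineK QBfin) -!EFinM lee_fin => h.
  have : 0 <= fine (Q B) by exact/fine_ge0/measure_ge0.
  move=> h0; congr EFin; apply/eqP; rewrite eq_le h0 andbT -(pmulr_rle0 _ e0); lra.
have : {ae Q, forall s, ~ B s} by exists B; split => // s /= /contrapT.
move: le_c; apply: filterS2 => s le_c nBs.
have [k] : exists k, ~ (2 * e <= c k s).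
  by apply/not_existsP => h; apply: nBs => k _; apply: contrapT; exact: h.
move=> /negP; rewrite -ltNge => /ltW ck; exists k => q qN.
exact: (le_trans (le_c (k, q) qN)).
Qed.

End modulus.


Let ae_small_increments : {ae Q, forall s, small_increments (v^~ s)}.
Proof.
have : {ae Q, forall s, forall Nj : nat * nat, exists k : nat, forall q : rat,
    `|q| <= Nj.1%:R -> v (q + k.+1%:R^-1) s - v q s <= 2 * Nj.2.+1%:R^-1}.
  by apply: ae_forall_countable => -[N j]; apply: ae_cond_exp_increment; rewrite invr_gt0.
apply: filterS => s h N e e0.
(* With j the integer part of [2 / e], the bound 2/(j+1) is at most [e]. *)
have [k hk] := h (N, Num.truncn (2 / e)).
exists k => q /hk /le_trans; apply => /=.
by rewrite ler_pdivrMr// mulrC -ler_pdivrMr// ltW// truncnS_gt.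
Qed.

Lemma rat_cond_exp_regular : exists uX : S -> R -> R, regular measurable uX /\
  forall q : rat, is_cond_exp (u^~ (ratr q)) (uX^~ (ratr q)).
Proof.
have : {ae Q, forall s, [/\ {homo v^~ s : p q / p < q}, v 0 s = 0 &
    small_increments (v^~ s)]}.
  by move: ae_incr ae_0 ae_small_increments; apply: filterS3 => s.
move=> [N [mN QN0 goodN]].
have {}goodN s : ~ N s -> [/\ {homo v^~ s : p q / p < q}, v 0 s = 0 &
    small_increments (v^~ s)].
  by move=> nNs; apply: contrapT => ngood; apply: nNs; exact: goodN.
(* On the exceptional set the identity is used instead, so that regularity
   holds at every point. *)
pose v' q := splice N (cst (ratr q)) (v q).
have v'in s : N s -> v'^~ s = ratr.
  by move=> Ns; apply/funext => q; rewrite /v' splice_in.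
have v'out s : ~ N s -> v'^~ s = v^~ s.
  by move=> Ns; apply/funext => q; rewrite /v' splice_out.
have v'_incr s : {homo v'^~ s : p q / p < q}.
  have [Ns|Ns] := pselect (N s); last by rewrite (v'out _ Ns); have [] := goodN _ Ns.
  by rewrite (v'in _ Ns) => p q; rewrite ltr_rat.
have v'_small s : small_increments (v'^~ s).
  have [Ns|Ns] := pselect (N s); last by rewrite (v'out _ Ns); have [] := goodN _ Ns.
  by rewrite (v'in _ Ns); exact: small_increments_ratr.
have v'0 s : v' 0 s = 0.
  have [Ns|Ns] := pselect (N s); rewrite /v'.
    by rewrite splice_in// /cst rmorph0.
  by rewrite splice_out//; have [] := goodN _ Ns.
have mv' q : measurable_fun setT (v' q).
  by apply: measurable_splice => //; have [] := vE q.
exists (fun s => rat_ext (v'^~ s)); split.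
  split.
  - by move=> s; exact: rat_ext_continuous.
  - by move=> s; exact: rat_ext_incr.
  - by move=> s; rewrite -[X in rat_ext _ X](rmorph0 (@ratr R)) rat_extE.
  - move=> B mB; rewrite prod_sigma_measurableE -[Z in measurable Z]setTI.
    exact: measurable_rat_ext.
(* At rationals the extension returns [v' q], which differs from [v q] only on the null set [N]. *)
move=> q; rewrite [X in is_cond_exp _ X](_ : _ = v' q); last first.
  by apply/funext => s; rewrite rat_extE.
apply: (is_cond_exp_ae (vE q)) => //.
exists N; split => // s /= /not_implyP[_ v'v]; apply: contrapT => Ns.
by apply: v'v; rewrite /v' splice_out.
Qed.

End conditional_utility.

Section conditional_utility_existence.
Context {d d' : measure_display} {T : measurableType d} {S : measurableType d'}.
Context {R : realType} (P : probability T R) (X : {mfun T >-> S}).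

(** Passing from rational to real [x] is the substitution result applied to the constant function
    [x]. *)
Lemma cond_exp_regular (u : T -> R -> R) : regular measurable u ->
  (forall x, P.-integrable setT (fun w => (u w x)%:E)) ->
  exists uX : S -> R -> R, regular measurable uX /\
    forall x, is_cond_exp P X (u^~ x) (uX^~ x).
Proof.
move=> ru iu.
have /choice[v vE] : forall q : rat, exists vq, is_cond_exp P X (u^~ (ratr q)) vq.
  by move=> q; apply: cond_exp_exists; exact: iu.
have [uX [ruX uXE]] := rat_cond_exp_regular ru (fun q => iu (ratr q)) vE.
have iuX q : (distribution P X).-integrable setT (fun s => (uX s (ratr q))%:E).
  by have [] := uXE q.
have bx x : Defs.bounded_fun (cst x : S -> R) by exists `|x|.
exists uX; split => // x; split.
- exact: measurable_regular_comp.
- exact: (integrable_regular_comp ruX iuX _ (bx x)).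
- move=> B mB.
  by rewrite (integral_cond_exp_comp ruX ru (fun q => iu (ratr q)) uXE _ (bx x)).
Qed.

End conditional_utility_existence.

(** * The generalized inverse of a regular function *)

Section generalized_inverse.
Context {d : measure_display} {S : measurableType d} {R : realType}.
Variable phi : S -> R -> R.
Hypothesis rphi : regular measurable phi.

Lemma PhiG_regularK s y : PhiG phi s (phi s y) = y%:E.
Proof.
apply/eqP; rewrite eq_le; apply/andP; split.
  apply/lee_addgt0Pr => e e0; apply: ereal_inf_lbound.
  by exists (y + e) => //=; rewrite regular_lt// ltrDl.
by apply: le_ereal_inf_tmp => _ [z /= + <-]; rewrite regular_lt// lee_fin => /ltW.
Qed.

Lemma measurable_PhiG : measurable_fun setT (fun p : S * R => PhiG phi p.1 p.2).
Proof.
apply: (measurability _ (ErealGenInftyO.measurableE R)) => //.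
move=> /= _ [_ [r ->] <-]; rewrite setTI.
(* By monotonicity, the infimum is below [r] exactly when some rational [q] below [r] already
   satisfies [x < phi s q]. *)
rewrite [Z in measurable Z](_ : _ = \bigcup_(q : rat)
    [set p | ratr q < r /\ p.2 < phi p.1 (ratr q)]).
  apply: bigcupT_measurable_rat => q.
  have [qr|qr] := boolP (ratr q < r); last first.
    by rewrite [Z in measurable Z](_ : _ = set0)//; apply/seteqP; split => // p [].
  rewrite [Z in measurable Z](_ : _ =
      setT `&` [set p : S * R | p.2 < phi p.1 (ratr q)]); last first.
    by apply/seteqP; split => // p [].
  apply: (measurable_fun_ltr _ _ measurableT (Y := [set true]) Logic.I) => //.
  apply: (measurableT_comp (measurable_regular_comp (h := cst (ratr q)) rphi _)) => //.
apply/seteqP; split => [[s x]|[s x] [q _ /= [qr xq]]] /=; rewrite in_itv/=.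
  move=> /ereal_inf_lt[_ [y /= xy <-]]; rewrite lte_fin => /exists_rat_between[q /andP[yq qr]].
  by exists q => //; split => //; rewrite (lt_trans xy)// regular_lt.
by apply: (@le_lt_trans _ _ (ratr q)%:E); rewrite ?lte_fin//; apply: ereal_inf_lbound; exists (ratr q).
Qed.

End generalized_inverse.

(** * Conditional certainty equivalents *)

Section certainty_equivalent.
Context {d d' : measure_display} {T : measurableType d} {S : measurableType d'}.
Context {R : realType} (P : probability T R) (X : {mfun T >-> S}).
Variables (u : T -> R -> R) (uX : S -> R -> R).
Hypotheses (ru : regular measurable u) (ruX : regular measurable uX).
Hypothesis iu : forall x, P.-integrable setT (fun w => (u w x)%:E).
Hypothesis uXE : forall x, is_cond_exp P X (u^~ x) (uX^~ x).

(** The equation is solved at every point, not just almost surely, so that the generalized inverse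
    of [uX] at [g] returns [h] everywhere. *)
Lemma cond_certainty_equivalent (f : T -> R) : Linf f -> exists g h : S -> R,
  [/\ is_cond_exp P X (fun w => u w (f w)) g, measurable_fun setT h,
      Defs.bounded_fun h & forall s, uX s (h s) = g s].
Proof.
move=> [mf [M fM]].
have iuf := integrable_regular_comp ru (fun q => iu (ratr q)) mf (ex_intro _ M fM).
have M0 : 0 <= M by exact: le_trans (normr_ge0 _) (fM point).
have [g0 g0E] := @cond_exp_exists _ _ _ _ _ P X (fun w => u w (f w)) iuf.
have ge_g0 : {ae distribution P X, forall s, uX s (- M) <= g0 s}.
  apply: (cond_exp_le_ae (iu _) iuf (uXE _) g0E) => w.
  by apply: regular_ndecr => //; have := fM w; rewrite ler_norml => /andP[].
have le_g0 : {ae distribution P X, forall s, g0 s <= uX s M}.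
  apply: (cond_exp_le_ae iuf (iu _) g0E (uXE _)) => w.
  by apply: regular_ndecr => //; have := fM w; rewrite ler_norml => /andP[].
(* Clamping [g0] between [uX (- M)] and [uX M] makes it invertible everywhere. *)
pose g := (uX^~ (- M)) \max ((uX^~ M) \min g0).
have mg : measurable_fun setT g.
  apply: measurable_maxr; first by have [] := uXE (- M).
  by apply: measurable_minr; [have [] := uXE M|have [] := g0E].
have gE : is_cond_exp P X (fun w => u w (f w)) g.
  apply: (is_cond_exp_ae g0E mg); move: ge_g0 le_g0; apply: filterS2 => s ge_s le_s _.
  by rewrite /g /= min_r// max_r.
have g_itv s : uX s (- M) <= g s <= uX s M.
  rewrite /g/= le_max lexx/= ge_max ge_min lexx/= andbT.
  by apply: regular_ndecr => //; lra.
have /choice[h hP] : forall s, exists y, `|y| <= M /\ uX s y = g s.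
  move=> s; have MM : - M <= M by lra.
  have [cuX _ _ _] := ruX.
  have [] := @IVT R (uX s) (- M) M (g s) MM.
  - exact/continuous_subspaceT/cuX.
  - have uMM := regular_ndecr s ruX MM.
    by rewrite min_l// max_r.
  - by move=> y; rewrite in_itv/= => yM uy; exists y; rewrite ler_norml.
exists g, h; split => //; last 2 first.
- by exists M => s; have [] := hP s.
- by move=> s; have [] := hP s.
(* Although [h] comes from a choice, strict monotonicity rewrites the event [h > c] as
   [uX s c < g s]. *)
apply: (measurability _ (RGenOInfty.measurableE R)) => //.
move=> /= _ [_ [c ->] <-]; rewrite preimage_itvoy.
rewrite [Z in measurable Z](_ : _ = setT `&` [set s | uX s c < g s]).
  apply: (measurable_fun_ltr _ _ measurableT (Y := [set true]) Logic.I) => //.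
  by have [] := uXE c.
by apply/seteqP; split => s [_ /=]; have [_ <-] := hP s; rewrite regular_lt.
Qed.

End certainty_equivalent.

(** * Sub-sigma-algebras as targets of the identity map *)

Section sub_sigma_algebra.
Context {d : measure_display} {T : measurableType d} {R : realType}.
Variables (G : set (set T)) (P : probability T R).
Hypothesis sG : sub_sigma G.

Let S := g_sigma_algebraType G.

Lemma sub_sigma_measurableE : @measurable _ (g_sigma_algebraType G) = G.
Proof. by have [sigG _] := sG; exact: measurable_g_measurableTypeE. Qed.

Lemma measurable_sub_sigma_id : measurable_fun setT (idfun : T -> S).
Proof.
move=> _ B; rewrite sub_sigma_measurableE setTI preimage_id => GB.
by have [_] := sG; exact.
Qed.

HB.instance Definition _ :=
  isMeasurableFun.Build _ _ _ _ (idfun : T -> S) measurable_sub_sigma_id.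

Definition sub_sigma_id : {mfun T >-> S} := idfun : T -> S.

Lemma regular_sub_sigma (phi : S -> R -> R) :
  regular measurable phi -> @regular _ T R G phi.
Proof. by rewrite sub_sigma_measurableE. Qed.

(** The image of [P] under the identity is [P] restricted to [G], so integrals against it transfer
    back to [P] by change of variables. *)
Lemma cond_exp_version_sub_sigma (k : T -> R) (v : S -> R) :
  is_cond_exp P sub_sigma_id k v -> @cond_exp_version _ T R P G k v.
Proof.
move=> [mv iv vE].
have mvT : measurable_fun setT (v : T -> R).
  exact: (measurableT_comp mv measurable_sub_sigma_id).
have ivT : P.-integrable setT (EFin \o (v : T -> R)).
  move: iv => /integrableP[_ iv]; apply/integrableP; split; first exact/measurable_EFinP.
  move: iv; rewrite ge0_integral_pushforward//.
  by apply: measurableT_comp => //; exact/measurable_EFinP.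
split => //.
- by move=> B mB; rewrite -sub_sigma_measurableE -[Z in measurable Z]setTI; exact: mv.
- move=> A GA; have mA : @measurable _ S A by rewrite sub_sigma_measurableE.
  have mAT : measurable (A : set T) by have [_] := sG; exact.
  rewrite -[RHS](vE _ mA) integral_pushforward//; first exact/measurable_EFinP.
  exact: (integrableS measurableT).
Qed.

End sub_sigma_algebra.

(** * Conditional Chisini means *)

Lemma Linf_splice0 {d} {T : measurableType d} {R : realType} (A : set T) (f : T -> R) :
  measurable A -> Linf f -> Linf (splice A f (cst 0)).
Proof.
move=> mA [mf [M fM]]; split; first exact: measurable_splice.
exists M => w; have [Aw|Aw] := pselect (A w); first by rewrite splice_in.
by rewrite splice_out// normr0 (le_trans _ (fM w)).
Qed.

(** Because [u w 0] is zero, the part off [A] contributes nothing. *)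
Lemma integral_regular_splice0 {d} {T : measurableType d} {R : realType}
    (mu : {measure set T -> \bar R}) (u : T -> R -> R) (A : set T) (f : T -> R) :
  regular measurable u ->
  (\int[mu]_(w in setT) (u w (splice A f (cst 0) w))%:E =
   \int[mu]_(w in A) (u w (f w))%:E)%E.
Proof.
move=> [_ _ u0 _]; rewrite [RHS]integral_mkcond; apply: eq_integral => w _.
rewrite patchE; have [Aw|Aw] := boolP (w \in A).
  by rewrite splice_in//; exact/set_mem.
by rewrite splice_out ?u0//; move: Aw; rewrite notin_setE.
Qed.

Theorem mainTheorem5 (d : measure_display) (T : measurableType d) (R : realType)
  (pref : (T -> R) -> (T -> R) -> Prop) (u : T -> R -> R) (P : probability T R) :
  (exists A B C : set T, [/\ measurable A, measurable B & measurable C] /\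
     [/\ A `&` B = set0, A `&` C = set0 & B `&` C = set0] /\
     [/\ ~ null_event pref A, ~ null_event pref B & ~ null_event pref C]) ->
  preference_order pref -> SM pref -> PC pref -> ST pref ->
  (forall A : set T, measurable A -> (null_event pref A <-> P A = 0%E)) ->
  regular measurable u ->
  (forall x : R, P.-integrable setT (fun w => (u w x)%:E)) ->
  (forall f g : T -> R, Linf f -> Linf g ->
     (pref f g <-> (\int[P]_(w in setT) (u w (g w))%:E <=
                     \int[P]_(w in setT) (u w (f w))%:E)%E)) ->
  forall (G : set (set T)) (f : T -> R), sub_sigma G -> Linf f ->
  chisini pref G f !=set0 /\
  exists uG : T -> R -> R,
    [/\ regular G uG,
        (forall x : R, cond_exp_version P G (fun w => u w x) (uG^~ x)),
        (forall B : set (\bar R), measurable B ->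
           prod_sigma G ((fun p : T * R => PhiG uG p.1 p.2) @^-1` B)) &
        exists g : T -> R, cond_exp_version P G (fun w => u w (f w)) g /\
          exists h : T -> R, chisini pref G f h /\
            forall w, PhiG uG w (g w) = (h w)%:E].
Proof.
move=> _ _ _ _ _ _ ru iu prefE G f sG Lf.
have mGE := sub_sigma_measurableE sG.
pose X := sub_sigma_id sG.
have [uG [ruG uGE]] := cond_exp_regular X ru iu.
have [g [h [gE mh bh hg]]] := cond_certainty_equivalent ru ruG iu uGE Lf.
have hchi : chisini pref G f h.
  have GmT A : G A -> measurable A by have [_] := sG; exact.
  have Lh : @Linf _ T R h.
    by split => //; exact: (measurableT_comp mh (measurable_sub_sigma_id sG)).
  split.
    by split => // B mB; rewrite -mGE -[Z in measurable Z]setTI; exact: mh.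
  move=> A GA; have mA := GmT _ GA.
  have LfA := Linf_splice0 mA Lf; have LhA := Linf_splice0 mA Lh.
  have fhE : (\int[P]_(w in setT) (u w (splice A f (cst 0) w))%:E =
      \int[P]_(w in setT) (u w (splice A h (cst 0) w))%:E)%E.
    (* Over [A], the integral of u(., f) equals that of [g], which is uG(., h), and hence that of
       u(., h) by substitution. *)
    rewrite !integral_regular_splice0//.
    have mAG : @measurable _ (g_sigma_algebraType G) A by rewrite mGE.
    have [_ _ /(_ _ mAG) <-] := gE.
    rewrite -(integral_cond_exp_comp ruG ru (fun q => iu (ratr q))
      (fun q => uGE (ratr q)) mh bh mAG).
    by apply: eq_integral => s _; rewrite hg.
  by split; [apply/(prefE _ _ LfA LhA)|apply/(prefE _ _ LhA LfA)]; rewrite fhE.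
split; first by exists h.
exists uG; split.
- exact: (regular_sub_sigma sG).
- by move=> x; exact: (cond_exp_version_sub_sigma (uGE x)).
- move=> B mB; have := measurable_PhiG ruG measurableT mB.
  by rewrite setTI -prod_sigma_measurableE mGE.
- exists g; split; first exact: (cond_exp_version_sub_sigma gE).
  by exists h; split => // w; rewrite -hg; exact: (PhiG_regularK ruG).
Qed.
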